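(* Let $A\in\mathbb{R}^{n\times n}$, $B\in\mathbb{R}^{n\times m}$, $Q\in\mathbb{R}^{n\times n}$, $S\in\mathbb{R}^{n\times m}$, $R\in\mathbb{R}^{m\times m}$ be such that $\Pi=\begin{bmatrix} Q & S \\ S^\top & R \end{bmatrix}=\Pi^\top\ge 0$, and let $\Sigma=(A,B;\Pi)$. Let $A_0=A-BR^\dagger S^\top$ and $Q_0=Q-SR^\dagger S^\top$. Assume that $R$ is singular, that $A_0$ is non-singular, and that $A_0^{-1}B\ker R\neq\{0\}$. Let $\eta=\dim(A_0^{-1}B\ker R)$ and let $V=[\,V_1\;\;V_2\,]\in\mathbb{R}^{n\times n}$ be an orthogonal matrix with $\operatorname{im}V_2=A_0^{-1}B\ker R$ (so $V_2$ has $\eta$ columns). Let $A_V=V^\top A_0V$, $B_V=V^\top B$, $A_1=V_1^\top A_0V_1\in\mathbb{R}^{(n-\eta)\times(n-\eta)}$, $B_1=V_1^\top B\in\mathbb{R}^{(n-\eta)\times m}$, $R_1=R+B^\top Q_0B$, and $Q_V=V^\top Q_0V=\begin{bmatrix} Q_{11} & Q_{12} \\ Q_{12}^\top & Q_{22} \end{bmatrix}$ with $Q_{11}\in\mathbb{R}^{(n-\eta)\times(n-\eta)}$. Let $Q_1\in\mathbb{R}^{(n-\eta)\times(n-\eta)}$ be the upper-left block of $A_V^\top Q_VA_V$ and let $S_1\in\mathbb{R}^{(n-\eta)\times m}$ be the matrix formed by the first $n-\eta$ rows of $A_V^\top Q_VB_V$. 1. Let $X$ be a solution of CGDARE($\Sigma$),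 and partition $X_V=V^\top XV=\begin{bmatrix} X_{11} & X_{12} \\ X_{12}^\top & X_{22} \end{bmatrix}$ with $X_{11}\in\mathbb{R}^{(n-\eta)\times(n-\eta)}$. Then: (i) $X_{12}=Q_{12}$ and $X_{22}=Q_{22}$; (ii) the matrix $\Pi_1=\begin{bmatrix} Q_1 & S_1 \\ S_1^\top & R_1 \end{bmatrix}$ is positive semidefinite; (iii) $\Delta_1=X_{11}-Q_{11}$ satisfies CGDARE($\Sigma_1$) with $\Sigma_1=(A_1,B_1;\Pi_1)$, that is, $$\Delta_1=A_1^\top\Delta_1A_1-(A_1^\top\Delta_1B_1+S_1)(R_1+B_1^\top\Delta_1B_1)^\dagger(B_1^\top\Delta_1A_1+S_1^\top)+Q_1,$$ $$\ker(R_1+B_1^\top\Delta_1B_1)\subseteq\ker(S_1+A_1^\top\Delta_1B_1).$$ 2. Conversely, if $\Delta_1$ is a (symmetric) solution of the two relations in (iii), then $$X=V\begin{bmatrix} \Delta_1+Q_{11} & Q_{12} \\ Q_{12}^\top & Q_{22} \end{bmatrix}V^\top$$ is a solution of CGDARE($\Sigma$).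
   Context: $M^\dagger$ denotes the Moore-Penrose pseudo-inverse of a real matrix $M$. For $\Sigma=(A,B;\Pi)$ with $\Pi=\begin{bmatrix} Q & S \\ S^\top & R \end{bmatrix}=\Pi^\top\ge0$ (positive semidefinite), CGDARE($\Sigma$) (the constrained generalized discrete-time algebraic Riccati equation) is the pair of relations in the unknown $X$ $$X=A^\top XA-(A^\top XB+S)(R+B^\top XB)^\dagger(S^\top+B^\top XA)+Q,$$ $$\ker(R+B^\top XB)\subseteq\ker(A^\top XB+S).$$ Only real symmetric solutions are considered: ''solution'' always means real symmetric solution. $A_0^{-1}B\ker R$ denotes the subspace $\{A_0^{-1}Bw: w\in\ker R\}$ of $\mathbb{R}^n$. *)

(* Defs.v *)
From mathcomp Require Import all_boot all_order all_algebra.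
Import Order.TTheory GRing.Theory Num.Theory.
Set Implicit Arguments.
Unset Strict Implicit.
Unset Printing Implicit Defensive.
Local Open Scope ring_scope.

(* Matrices act on column vectors on the left; kermx and the %MS operations of
   mxalgebra act on rows, hence the detour through {vspace 'cV_n}. *)
Definition mxker (F : fieldType) (m n : nat) (M : 'M[F]_(m, n)) :
    {vspace 'cV[F]_n} :=
  lker (linfun (mulmx M : 'cV[F]_n -> 'cV[F]_m)).

Definition mximg (F : fieldType) (m n : nat) (M : 'M[F]_(m, n))
    (U : {vspace 'cV[F]_n}) : {vspace 'cV[F]_m} :=
  (linfun (mulmx M : 'cV[F]_n -> 'cV[F]_m) @: U)%VS.

Lemma mem_mxker (F : fieldType) (m n : nat) (M : 'M[F]_(m, n)) (x : 'cV[F]_n) :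
  (x \in mxker M) = (M *m x == 0).
Proof. by rewrite memv_ker lfunE. Qed.

Lemma mem_mximg (F : fieldType) (m n : nat) (M : 'M[F]_(m, n))
    (U : {vspace 'cV[F]_n}) (y : 'cV[F]_m) :
  reflect (exists2 x, x \in U & y = M *m x) (y \in mximg M U).
Proof.
apply: (iffP memv_imgP) => [[x xU ->]|[x xU ->]]; exists x => //;
  by rewrite lfunE.
Qed.

Definition penrose (F : realFieldType) (m n : nat) (M : 'M[F]_(m, n))
    (X : 'M[F]_(n, m)) : bool :=
  [&& M *m X *m M == M, X *m M *m X == X,
      (M *m X)^T == M *m X & (X *m M)^T == X *m M].

Lemma gram_unit (F : realFieldType) (m n : nat) (M : 'M[F]_(m, n)) :
  row_free M -> M *m M^T \in unitmx.
Proof.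
move=> Mfree; rewrite -row_free_unit; apply: inj_row_free => v.
rewrite mulmxA => vMM.
suff vM0 : v *m M = 0.
  by apply: (row_free_inj Mfree); rewrite vM0 mul0mx.
have /matrixP/(_ 0 0) : (v *m M) *m (v *m M)^T = 0.
  by rewrite trmx_mul mulmxA vMM mul0mx.
rewrite !mxE => s0; apply/rowP => j; rewrite [RHS]mxE; apply/eqP.
have s_ge0 k : true -> 0 <= (v *m M) 0 k * (v *m M)^T k 0.
  by move=> _; rewrite [_^T _ _]mxE -expr2 sqr_ge0.
have /allP/(_ j (mem_index_enum j)) : all (fun k => true ==>
    ((v *m M) 0 k * (v *m M)^T k 0 == 0)) (index_enum _).
  by rewrite -psumr_eq0 // s0.
by rewrite [_^T _ _]mxE mulf_eq0 orbb.
Qed.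

Lemma penrose_ex (F : realFieldType) (m n : nat) (M : 'M[F]_(m, n)) :
  exists X, penrose M X.
Proof.
have [r [C [E [Cfree Efree ->]]]] : exists r (C : 'M_(m, r)) (E : 'M_(r, n)),
    [/\ row_free C^T, row_free E & M = C *m E].
  exists (\rank M), (col_base M), (row_base M).
  rewrite row_base_free mulmx_base /row_free mxrank_tr; split=> //.
  exact: col_base_full.
have E_unit : E *m E^T \in unitmx by apply: gram_unit.
have C_unit : C^T *m C \in unitmx by rewrite -{2}[C]trmxK gram_unit.
exists (E^T *m invmx (E *m E^T) *m (invmx (C^T *m C) *m C^T)).
set P := E^T *m invmx _; set L := invmx _ *m C^T.
have EP : E *m P = 1%:M by rewrite mulmxA mulmxV.
have LC : L *m C = 1%:M by rewrite -mulmxA mulVmx.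
have MX : C *m E *m (P *m L) = C *m L.
  by rewrite -mulmxA (mulmxA E) EP mul1mx.
have XM : P *m L *m (C *m E) = P *m E.
  by rewrite -mulmxA (mulmxA L) LC mul1mx.
rewrite /penrose MX XM; apply/and4P; split; apply/eqP.
- by rewrite -mulmxA (mulmxA L) LC mul1mx.
- by rewrite -mulmxA (mulmxA E) EP mul1mx.
- by rewrite /L !trmx_mul trmxK trmx_inv trmx_mul trmxK mulmxA.
- by rewrite /P !trmx_mul trmxK trmx_inv trmx_mul trmxK mulmxA.
Qed.

Lemma penrose_uniq (F : realFieldType) (m n : nat) (M : 'M[F]_(m, n)) X Y :
  penrose M X -> penrose M Y -> X = Y.
Proof.
case/and4P=> /eqP MXM /eqP XMX /eqP MXt /eqP XMt.
case/and4P=> /eqP MYM /eqP YMY /eqP MYt /eqP YMt.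
have eqM : M *m X = M *m Y.
  by rewrite -MXt -{1}MYM -mulmxA trmx_mul MXt MYt mulmxA MXM.
have eqM' : X *m M = Y *m M.
  rewrite -XMt -{1}MYM -mulmxA mulmxA trmx_mul XMt YMt.
  by rewrite -mulmxA (mulmxA M) MXM.
by rewrite -XMX eqM' -mulmxA eqM mulmxA YMY.
Qed.

Definition mpinv (F : realFieldType) (m n : nat) (M : 'M[F]_(m, n)) :
    'M[F]_(n, m) :=
  xchoose (penrose_ex M).

Lemma mpinvP (F : realFieldType) (m n : nat) (M : 'M[F]_(m, n)) :
  penrose M (mpinv M).
Proof. exact: (xchooseP (penrose_ex M)). Qed.

Definition psdmx (F : realFieldType) (n : nat) (M : 'M[F]_n) : Prop :=
  M^T = M /\ forall x : 'cV[F]_n, 0 <= (x^T *m M *m x) 0 0.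

(* The two identities together force m = n; the two formats are kept separate
   so that a square matrix can have the type 'M_(n, (n - r) + r) of a matrix
   split into two blocks of columns. *)
Definition orthogonalmx (F : realFieldType) (m n : nat) (V : 'M[F]_(m, n)) :
    Prop :=
  V^T *m V = 1%:M /\ V *m V^T = 1%:M.

Definition popov (F : realFieldType) (n m : nat) (Q : 'M[F]_n)
    (S : 'M[F]_(n, m)) (R : 'M[F]_m) : 'M[F]_(n + m) :=
  block_mx Q S S^T R.

(* X is a symmetric solution of CGDARE(A, B; popov Q S R). *)
Definition cgdare_sol (F : realFieldType) (n m : nat) (A : 'M[F]_n)
    (B : 'M[F]_(n, m)) (Q : 'M[F]_n) (S : 'M[F]_(n, m)) (R : 'M[F]_m)
    (X : 'M[F]_n) : Prop :=
  [/\ X^T = X,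
      X = A^T *m X *m A
          - (A^T *m X *m B + S) *m mpinv (R + B^T *m X *m B)
            *m (S^T + B^T *m X *m A)
          + Q
    & (mxker (R + B^T *m X *m B)
       <= mxker (A^T *m X *m B + S))%VS].

(* Main.v *)
(* Eliminating the pseudo-inverse, X = X^T solves CGDARE iff some gain K
   satisfies A^T X (A - B K) + Q - S K = X and B^T X (A - B K) + S^T = R K.
   Since ker R <= ker S, the feedback R^+ S^T turns (A, Q, S) into (A0, Q0, 0).
   If A0 v = B w with R w = 0, applying the transposed first equation to v gives
   X v = Q0 v + (B^T X (A0 - B K))^T w = Q0 v + K^T R w = Q0 v, so X and Q0 agree
   on im V2 and X = Q0 + V1 D V1^T.  Compressing the two equations by V1 gives
   those of the reduced problem with gain K V1; conversely a reduced gain K1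
   lifts to K = K1 V1^T + W V2^T, where A0 V2 = B W and R W = 0, because then
   (A0 - B K) V2 = 0. *)
Require Import Defs.
From mathcomp Require Import all_boot all_order all_algebra.
From mathcomp Require Import reals ring.
Import Order.TTheory GRing.Theory Num.Theory.
Local Open Scope ring_scope.

Section Reduction.
Set Implicit Arguments.
Unset Strict Implicit.
Unset Printing Implicit Defensive.
Variable F : realFieldType.

(** * Pseudo-inverses and the gain form of the Riccati equation *)

Lemma ker_sub_mpinv (m n p : nat) (M : 'M[F]_(m, n)) (N : 'M[F]_(p, n)) :
  (forall x : 'cV_n, M *m x = 0 -> N *m x = 0) -> N *m mpinv M *m M = N.
Proof.
have /and4P[/eqP MM'M _ _ _] := mpinvP M.
(* Each column of [1 - mpinv M *m M] lies in the kernel of [M], hence in that of [N]. *)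
move=> kerMN; apply/eqP; rewrite -subr_eq0 -[X in _ - X]mulmx1 -mulmxA -mulmxBr.
apply/eqP/trmx_inj/row_matrixP => j; rewrite trmx0 row0 -tr_col.
rewrite colE -mulmxA kerMN ?trmx0 // mulmxA mulmxBr mulmx1 mulmxA MM'M subrr.
by rewrite mul0mx.
Qed.

Lemma mpinv_sandwich (n p : nat) (M : 'M[F]_n) (K : 'M[F]_(n, p)) :
  K^T *m M *m mpinv M *m (M *m K) = K^T *m M *m K.
Proof.
have /and4P[/eqP MM'M _ _ _] := mpinvP M.
by rewrite -!mulmxA (mulmxA (mpinv M)) (mulmxA M (_ *m _)) (mulmxA M) MM'M.
Qed.

(* The kernel inclusion says that (R + B^T X B) K = S^T + B^T X A is solvable
   for K, and the Riccati term does not depend on the solution K chosen. *)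
Lemma cgdare_solP (n m : nat) (A : 'M[F]_n) (B : 'M[F]_(n, m)) (Q : 'M[F]_n)
    (S : 'M[F]_(n, m)) (R : 'M[F]_m) (X : 'M[F]_n) :
  R^T = R ->
  cgdare_sol A B Q S R X <->
  X^T = X /\ exists K : 'M[F]_(m, n),
    A^T *m X *m (A - B *m K) + Q - S *m K = X /\
    B^T *m X *m (A - B *m K) + S^T = R *m K.
Proof.
move=> Rsym; rewrite /cgdare_sol.
set RX := R + _; set SX := _ + S.
have eqR K : (B^T *m X *m (A - B *m K) + S^T = R *m K) <->
    RX *m K = S^T + B^T *m X *m A.
  rewrite mulmxBr mulmxDl -[_ *m B *m K]mulmxA; set b := _ *m (B *m K).
  split=> [<-|eqK]; first by rewrite addrAC addrNK addrC.
  by rewrite -(addrK b (R *m K)) eqK addrC addrA.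
have eqQ K : A^T *m X *m (A - B *m K) + Q - S *m K =
    A^T *m X *m A - SX *m K + Q.
  rewrite mulmxBr mulmxDl mulmxA opprD addrA; apply: addrAC.
split=> [[Xsym eqX kerX]|[Xsym [K [eqX /eqR eqK]]]].
- have SXT : SX^T = S^T + B^T *m X *m A.
    by rewrite linearD /= !trmx_mul trmxK Xsym mulmxA addrC.
  have RXsym : RX^T = RX.
    by rewrite linearD /= !trmx_mul trmxK Xsym Rsym mulmxA.
  have /and4P[/eqP RR'R _ _ _] := mpinvP RX.
  have SXR : SX *m mpinv RX *m RX = SX.
    apply: ker_sub_mpinv => x /eqP; rewrite -mem_mxker => /(subvP kerX).
    by rewrite mem_mxker => /eqP.
  (* The pseudo-inverse gain solves [RX *m K = SX^T] exactly, because the kernel inclusion gives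
     [SX *m mpinv RX *m RX = SX]. *)
  split=> //; exists (mpinv RX *m SX^T); split.
    by rewrite eqQ mulmxA SXT -eqX.
  apply/eqR; rewrite -SXT -[in LHS]SXR -[in RHS]SXR !trmx_mul RXsym.
  by rewrite !mulmxA RR'R.
(* The transposed gain equation factors [SX] through [RX]. This gives the kernel inclusion, and
   reduces the pseudo-inverse term to [K^T *m RX *m K]. *)
- have SXT : SX = K^T *m RX.
    apply: trmx_inj; rewrite trmx_mul trmxK [RX^T]linearD /= [SX^T]linearD /=.
    by rewrite !trmx_mul !trmxK Xsym Rsym !mulmxA eqK addrC.
  split=> //.
    by rewrite -eqK SXT mpinv_sandwich -SXT -eqQ eqX.
  apply/subvP=> x; rewrite !mem_mxker SXT -mulmxA => /eqP->.
  by rewrite mulmx0.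
Qed.

(** * Positive semidefinite matrices *)

Lemma psdmx_form0 (n : nat) (M : 'M[F]_n) (z : 'cV[F]_n) :
  psdmx M -> z^T *m M *m z = 0 -> M *m z = 0.
Proof.
case=> Msym Mge0 Mz0; set u := M *m z.
have uu : (u^T *m u) 0 0 = \sum_i u i 0 ^+ 2.
  by rewrite mxE; apply: eq_bigr => i _; rewrite mxE expr2.
have b_ge0 : 0 <= (u^T *m u) 0 0.
  by rewrite uu; apply: sumr_ge0 => i _; apply: sqr_ge0.
suff /eqP : (u^T *m u) 0 0 = 0.
  rewrite uu psumr_eq0 => [/allP u0|i _]; last exact: sqr_ge0.
  apply/colP=> i; rewrite [RHS]mxE; apply/eqP.
  by rewrite -sqrf_eq0; apply: u0; apply: mem_index_enum.
have zM : z^T *m M = u^T by rewrite trmx_mul Msym.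
set b := (u^T *m u) 0 0 in b_ge0 *; set c := (u^T *m M *m u) 0 0.
have c_ge0 : 0 <= c := Mge0 u.
(* The form is evaluated along the line through [z] directed by its image [u]; its constant term
   vanishes by hypothesis. *)
have quad t : 0 <= t * (t * c - b *+ 2).
  have := Mge0 (z - t *: u); congr (_ <= _).
  have -> : (z - t *: u)^T *m M *m (z - t *: u) =
      t *: (t *: (u^T *m M *m u) - (u^T *m u) *+ 2).
    rewrite [_^T]linearB /= [(t *: u)^T]linearZ /= mulmxBl zM -scalemxAl mulmxBr.
    have uz : u^T *m z = 0 by rewrite -zM.
    have uMz : u^T *m M *m z = u^T *m u by rewrite -mulmxA.
    rewrite !mulmxBl -!scalemxAl uz uMz sub0r -!scalemxAr.
    by rewrite opprB addrCA -opprD -mulr2n scalerMnr -scalerBr; congr (_ *: (_ - _)).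
  rewrite [LHS]mxE; congr (_ * _); rewrite [LHS]mxE; congr (_ + _).
    by rewrite [LHS]mxE.
  by rewrite [LHS]mxE mulmxnE.
(* The expansion of (z - t u)^T M (z - t u) >= 0 forces b = 0; dividing by c + 1
   rather than c avoids the case c = 0. *)
have c1_gt0 : 0 < c + 1 by rewrite ltr_wpDl.
have := quad (b / (c + 1)); have -> : b / (c + 1) * (b / (c + 1) * c - b *+ 2) =
    - (b / (c + 1)) ^+ 2 * (c + 2).
  by field; rewrite gt_eqF.
rewrite mulNr oppr_ge0 pmulr_lle0; last by rewrite ltr_wpDl.
by rewrite le_eqVlt ltNge sqr_ge0 orbF sqrf_eq0 mulf_eq0 invr_eq0 orbC gt_eqF //
  => /eqP.
Qed.

(** For [w] in the kernel of [R] the quadratic form vanishes at the column (0, w), so the whole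
    matrix kills that column, and the upper block of the product is [S *m w]. *)
Lemma psdmx_block_ker (n m : nat) (Q : 'M[F]_n) (S : 'M[F]_(n, m))
    (R : 'M[F]_m) :
  psdmx (popov Q S R) ->
  [/\ Q^T = Q, R^T = R & forall w : 'cV_m, R *m w = 0 -> S *m w = 0].
Proof.
move=> Pi_psd; case: (Pi_psd) => Pi_sym _.
move: Pi_sym; rewrite /popov tr_block_mx => /eq_block_mx[Qsym _ _ Rsym].
split=> // w Rw0.
have /(psdmx_form0 Pi_psd) :
    (col_mx 0 w : 'cV_(n + m))^T *m popov Q S R *m col_mx 0 w = 0.
  by rewrite -mulmxA mul_block_col tr_col_mx mul_row_col Rw0 !(mulmx0, trmx0,
    mul0mx, addr0).
by rewrite mul_block_col !mulmx0 !add0r -(col_mx0 _ n) => /eq_col_mx[].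
Qed.

Lemma psdmx_gram (n p : nat) (M : 'M[F]_n) (C : 'M[F]_(n, p)) :
  psdmx M -> psdmx (C^T *m M *m C).
Proof.
case=> Msym Mge0; split=> [|x]; first by rewrite !trmx_mul trmxK Msym mulmxA.
by have := Mge0 (C *m x); rewrite trmx_mul !mulmxA.
Qed.

Lemma psdmx_drsub (n m : nat) (Q : 'M[F]_n) (S : 'M[F]_(n, m)) (R : 'M[F]_m) :
  psdmx (popov Q S R) -> psdmx R.
Proof.
move=> /(psdmx_gram (col_mx 0 1%:M)).
rewrite -mulmxA mul_block_col tr_col_mx mul_row_col trmx0 trmx1.
by rewrite mul0mx !mul1mx !mulmx0 !mulmx1 !add0r.
Qed.

Lemma psdmxD (n : nat) (M N : 'M[F]_n) : psdmx M -> psdmx N -> psdmx (M + N).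
Proof.
case=> Msym Mge0 [Nsym Nge0]; split=> [|x]; first by rewrite linearD /= Msym Nsym.
by rewrite mulmxDr mulmxDl mxE addr_ge0.
Qed.

(** * Removal of the cross term [S] by a preliminary feedback *)

Section Feedback.
Variables (n m : nat) (A : 'M[F]_n) (B : 'M[F]_(n, m)) (Q : 'M[F]_n).
Variables (S : 'M[F]_(n, m)) (R : 'M[F]_m).
Hypothesis Pi_psd : psdmx (popov Q S R).
Let A0 := A - B *m mpinv R *m S^T.
Let Q0 := Q - S *m mpinv R *m S^T.

Let T := mpinv R *m S^T.

Let RT : R *m T = S^T.
Proof.
have [_ Rsym kerRS] := psdmx_block_ker Pi_psd.
have /and4P[/eqP RR'R _ _ _] := mpinvP R.
have SRR := ker_sub_mpinv kerRS.
rewrite /T -[in LHS]SRR -[in RHS]SRR !trmx_mul Rsym !mulmxA.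
by rewrite RR'R.
Qed.

Let TR : T^T *m R = S.
Proof.
have [_ Rsym _] := psdmx_block_ker Pi_psd.
by apply: trmx_inj; rewrite trmx_mul trmxK Rsym RT.
Qed.

Let Q0E : Q0 = Q - S *m T.
Proof. by rewrite /Q0 /T mulmxA. Qed.

(** Since [R *m T = S^T], the Schur complement is the congruence of the Popov matrix by the block
    column (1, -T). *)
Lemma psdmx_schur : psdmx Q0.
Proof.
suff -> : Q0 = (col_mx 1%:M (- T))^T *m popov Q S R *m col_mx 1%:M (- T).
  exact: psdmx_gram.
rewrite -mulmxA mul_block_col tr_col_mx mul_row_col trmx1 mul1mx !mulmx1.
by rewrite !mulmxN RT subrr mulmx0 addr0 Q0E.
Qed.

(** Gains for the two problems differ by [T], which leaves the closed-loop matrix unchanged. In the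
    gain equation [R *m T] cancels [S^T]; the first equations then differ by [T^T] times the gain
    equation. *)
Lemma cgdare_sol_feedback (X : 'M[F]_n) :
  cgdare_sol A B Q S R X <->
  X^T = X /\ exists K : 'M[F]_(m, n),
    A0^T *m X *m (A0 - B *m K) + Q0 = X /\
    B^T *m X *m (A0 - B *m K) = R *m K.
Proof.
have [_ Rsym _] := psdmx_block_ker Pi_psd.
have A0E : A0 = A - B *m T by rewrite /A0 /T mulmxA.
have shift (K : 'M_(m, n)) :
    A^T *m X *m (A - B *m (K + T)) + Q - S *m (K + T) = X /\
    B^T *m X *m (A - B *m (K + T)) + S^T = R *m (K + T) <->
    A0^T *m X *m (A0 - B *m K) + Q0 = X /\
    B^T *m X *m (A0 - B *m K) = R *m K.
  have -> : A - B *m (K + T) = A0 - B *m K.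
    by rewrite A0E mulmxDr opprD addrA addrAC.
  rewrite [R *m _]mulmxDr RT.
  set AK := A0 - B *m K.
  have split2 : B^T *m X *m AK = R *m K ->
      A0^T *m X *m AK + Q0 = A^T *m X *m AK + Q - S *m (K + T).
    move=> eqK; rewrite A0E [(_ - _)^T]linearB /= trmx_mul !mulmxBl.
    rewrite -2!(mulmxA T^T) eqK (mulmxA T^T) TR Q0E mulmxDr opprD !addrA.
    by congr (_ - _); apply: addrAC.
  split=> [[e1 /addIr e2]|[e1 e2]]; split=> //.
  - by rewrite split2.
  - by rewrite -split2.
  - by rewrite e2.
rewrite (cgdare_solP _ _ _ _ _ Rsym); split=> -[Xsym [K eqK]]; split=> //.
  by exists (K - T); apply/shift; rewrite subrK.
by exists (K + T); apply/shift.
Qed.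

End Feedback.

(** * Compression to the image of [V1] *)

Section Deflation.
Variables (n m p q : nat) (A : 'M[F]_n) (B : 'M[F]_(n, m)) (Q : 'M[F]_n).
Variables (R : 'M[F]_m) (V1 : 'M[F]_(n, p)) (V2 : 'M[F]_(n, q)).
Variable W : 'M[F]_(m, q).
Hypotheses (Qsym : Q^T = Q) (Rsym : R^T = R).
Hypotheses (RW : R *m W = 0) (AV2 : A *m V2 = B *m W).
Hypotheses (V11 : V1^T *m V1 = 1%:M) (VV : V1 *m V1^T + V2 *m V2^T = 1%:M).

Lemma riccati_fixed_subspace (X : 'M[F]_n) (K : 'M[F]_(m, n)) :
  X^T = X -> A^T *m X *m (A - B *m K) + Q = X ->
  B^T *m X *m (A - B *m K) = R *m K -> (X - Q) *m V2 = 0.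
Proof.
set AK := A - _ => Xsym eqX eqK.
have eqXt : X = AK^T *m (X *m A) + Q.
  by rewrite -[LHS]Xsym -[in LHS]eqX linearD /= !trmx_mul trmxK Xsym Qsym.
rewrite [X in X - _]eqXt addrK -!mulmxA AV2.
have := congr1 trmx eqK; rewrite !trmx_mul trmxK Xsym Rsym => eqKt.
by rewrite (mulmxA X) mulmxA eqKt -mulmxA RW mulmx0.
Qed.

(** The right-hand side is the gain form of [cgdare_sol_feedback], so the two equivalences chain and
    serve both halves of the theorem. *)
Lemma deflated_cgdare_solP (D : 'M[F]_p) (X := Q + V1 *m D *m V1^T) :
  cgdare_sol (V1^T *m A *m V1) (V1^T *m B) (V1^T *m A^T *m Q *m A *m V1)
    (V1^T *m A^T *m Q *m B) (R + B^T *m Q *m B) D <->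
  X^T = X /\ exists K : 'M[F]_(m, n),
    A^T *m X *m (A - B *m K) + Q = X /\ B^T *m X *m (A - B *m K) = R *m K.
Proof.
have R1sym : (R + B^T *m Q *m B)^T = R + B^T *m Q *m B.
  by rewrite linearD /= !trmx_mul trmxK Qsym Rsym mulmxA.
rewrite (cgdare_solP _ _ _ _ _ R1sym).
have conj_inj (Y Z : 'M[F]_p) : V1 *m Y *m V1^T = V1 *m Z *m V1^T -> Y = Z.
  move/(congr1 (fun M => V1^T *m M *m V1)); rewrite !mulmxA V11 !mul1mx.
  by rewrite -!mulmxA V11 !mulmx1.
have Dsym : D^T = D <-> X^T = X.
  rewrite [X^T]linearD /= !trmx_mul trmxK Qsym mulmxA.
  by split=> [->//|/addrI/conj_inj].
(* [C] stands for the closed loop restricted to the image of [V1]. Expanding [X], the [Q] summand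
   produces the cost blocks of the reduced problem. *)
have eqs (K1 : 'M[F]_(m, p)) (C := A *m V1 - B *m K1) :
    (V1^T *m A *m V1)^T *m D *m (V1^T *m A *m V1 - V1^T *m B *m K1)
      + V1^T *m A^T *m Q *m A *m V1 - V1^T *m A^T *m Q *m B *m K1 = D /\
    (V1^T *m B)^T *m D *m (V1^T *m A *m V1 - V1^T *m B *m K1)
      + (V1^T *m A^T *m Q *m B)^T = (R + B^T *m Q *m B) *m K1 <->
    V1^T *m A^T *m X *m C = D /\ B^T *m X *m C = R *m K1.
  have VC : V1^T *m A *m V1 - V1^T *m B *m K1 = V1^T *m C.
    by rewrite mulmxBr !mulmxA.
  have XC (r : nat) (Y : 'M[F]_(r, n)) : Y *m X *m C =
      Y *m V1 *m D *m (V1^T *m C) + Y *m Q *m A *m V1 - Y *m Q *m B *m K1.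
    rewrite [Y *m X]mulmxDr mulmxDl addrC -addrA; congr (_ + _).
      by rewrite !mulmxA.
    by rewrite [LHS]mulmxBr !mulmxA.
  rewrite VC !XC !trmx_mul !trmxK Qsym mulmxDl !mulmxA.
  split=> -[-> e2]; split=> //; first by rewrite e2 addrK.
  by rewrite -e2 subrK.
split=> [[/Dsym Xsym [K1 /eqs[eqX eqK]]]|[Xsym [K [eqX eqK]]]].
- split=> //; exists (K1 *m V1^T + W *m V2^T).
  have -> : A - B *m (K1 *m V1^T + W *m V2^T) = (A *m V1 - B *m K1) *m V1^T.
    rewrite -{1}[A]mulmx1 -VV !mulmxDr !mulmxA AV2 mulmxBl opprD addrACA subrr.
    by rewrite addr0.
  set C := A *m V1 - _ in eqX eqK *.
  rewrite mulmxDr [R *m (W *m _)]mulmxA RW mul0mx addr0 !mulmxA eqK.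
  split=> //; rewrite [RHS]addrC; congr (_ *m _ + _).
  (* The reduced equation only controls the [V1] component of [A^T *m X *m C]; the [V2] component is
     [W^T *m R *m K1], which is zero. *)
  have V2AXC : V2^T *m (A^T *m X *m C) = 0.
    rewrite !mulmxA -trmx_mul AV2 trmx_mul -2!(mulmxA W^T) eqK mulmxA.
    by rewrite -Rsym -trmx_mul RW trmx0 mul0mx.
  rewrite -[LHS]mul1mx -VV mulmxDl -[V2 *m _ *m _]mulmxA V2AXC mulmx0 addr0.
  by rewrite -[LHS]mulmxA !(mulmxA V1^T) eqX.
- split; first exact/Dsym.
  exists (K *m V1); apply/eqs.
  have -> : A *m V1 - B *m (K *m V1) = (A - B *m K) *m V1.
    by rewrite mulmxBl mulmxA.
  rewrite !mulmxA eqK; split=> //.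
  have AXC : A^T *m X *m (A - B *m K) = V1 *m D *m V1^T.
    by apply: (addIr Q); rewrite eqX addrC.
  by rewrite -2!(mulmxA V1^T) AXC !mulmxA V11 mul1mx -mulmxA V11 mulmx1.
Qed.

End Deflation.

(** Preimages are chosen column by column and assembled into [W]. With [N] equal to [V2], this turns
    the subspace hypothesis into a matrix identity. *)
Lemma sub_mximgP (n m p q : nat) (M : 'M[F]_(n, m)) (R : 'M[F]_(p, m))
    (N : 'M[F]_(n, q)) :
  (mximg N fullv <= mximg M (mxker R))%VS ->
  exists2 W : 'M[F]_(m, q), R *m W = 0 & N = M *m W.
Proof.
move=> sNM.
have /fin_all_exists[f fP] (j : 'I_q) :
    exists x : 'cV[F]_m, R *m x = 0 /\ col j N = M *m x.
  have : col j N \in mximg N fullv.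
    by apply/mem_mximg; exists (delta_mx j 0); rewrite ?memvf ?colE.
  move=> /(subvP sNM)/mem_mximg[x]; rewrite mem_mxker => /eqP Rx0 ->.
  by exists x.
pose W := \matrix_(i, j) f j i 0.
have colW j : col j W = f j by apply/colP=> i; rewrite !mxE.
exists W.
  apply/matrixP=> i j; have [/colP/(_ i) + _] := fP j.
  by rewrite -colW colE mulmxA -colE !mxE.
apply/matrixP=> i j; have [_ /colP/(_ i)] := fP j.
by rewrite -colW [col j W]colE mulmxA -colE !mxE.
Qed.

End Reduction.

(** * Block identification and the two implications *)

Theorem theorem2 (K : realType) (n m : nat)
    (A : 'M[K]_n) (B : 'M[K]_(n, m))
    (Q : 'M[K]_n) (S : 'M[K]_(n, m)) (R : 'M[K]_m)
    (Pi_psd : psdmx (popov Q S R)) :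
  let A0 := A - B *m mpinv R *m S^T in
  let Q0 := Q - S *m mpinv R *m S^T in
  let U := mximg (invmx A0 *m B) (mxker R) in
  let eta := \dim U in
  forall (R_singular : R \notin unitmx)
    (A0_nonsingular : A0 \in unitmx)
    (U_neq0 : U <> 0%VS)
    (V1 : 'M[K]_(n, n - eta)) (V2 : 'M[K]_(n, eta)),
  let V := row_mx V1 V2 in
  forall (V_orthogonal : orthogonalmx V)
    (im_V2 : mximg V2 fullv = U),
  let A_V := V^T *m A0 *m V in
  let B_V := V^T *m B in
  let A1 := V1^T *m A0 *m V1 in
  let B1 := V1^T *m B in
  let R1 := R + B^T *m Q0 *m B in
  let Q_V := V^T *m Q0 *m V in
  let Q11 := ulsubmx Q_V in
  let Q12 := ursubmx Q_V in
  let Q22 := drsubmx Q_V in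
  let Q1 := ulsubmx (A_V^T *m Q_V *m A_V) in
  let S1 := usubmx (A_V^T *m Q_V *m B_V) in
  (forall X : 'M[K]_n, cgdare_sol A B Q S R X ->
     let X_V := V^T *m X *m V in
     [/\ ursubmx X_V = Q12 /\ drsubmx X_V = Q22,
         psdmx (popov Q1 S1 R1)
       & cgdare_sol A1 B1 Q1 S1 R1 (ulsubmx X_V - Q11)])
  /\
  (forall Delta1 : 'M[K]_(n - eta), cgdare_sol A1 B1 Q1 S1 R1 Delta1 ->
     cgdare_sol A B Q S R
       (V *m block_mx (Delta1 + Q11) Q12 Q12^T Q22 *m V^T)).
Proof.
move=> A0 Q0 U eta _ A0_unit _ V1 V2 V [VtV VVt] im_V2 A_V B_V A1 B1 R1 Q_V.
move=> Q11 Q12 Q22 Q1 S1.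
have [_ Rsym _] := psdmx_block_ker Pi_psd.
have Q0_psd : psdmx Q0 := psdmx_schur Pi_psd.
have Q0sym : Q0^T = Q0 by case: Q0_psd.
have [W RW V2E] : exists2 W : 'M[K]_(m, eta), R *m W = 0 &
    V2 = invmx A0 *m B *m W.
  by apply: sub_mximgP; rewrite im_V2.
have AV2 : A0 *m V2 = B *m W by rewrite V2E !mulmxA mulmxV // mul1mx.
have V11 : V1^T *m V1 = 1%:M.
  move: VtV; rewrite tr_row_mx mul_col_row scalar_mx_block.
  by move=> /eq_block_mx[].
have VV : V1 *m V1^T + V2 *m V2^T = 1%:M by rewrite -VVt tr_row_mx mul_row_col.
have blockV (M : 'M[K]_n) : V^T *m M *m V = block_mx (V1^T *m M *m V1)
    (V1^T *m M *m V2) (V2^T *m M *m V1) (V2^T *m M *m V2).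
  by rewrite tr_row_mx mul_col_mx mul_col_row.
have QVA : A_V^T *m Q_V = V^T *m A0^T *m Q0 *m V.
  rewrite /A_V /Q_V !trmx_mul trmxK !mulmxA.
  by rewrite -(mulmxA _ V V^T) VVt mulmx1.
have Q1E : Q1 = V1^T *m A0^T *m Q0 *m A0 *m V1.
  rewrite /Q1 QVA /A_V !mulmxA -(mulmxA _ V V^T) VVt mulmx1.
  rewrite -2!(mulmxA V^T) blockV block_mxKul.
  by rewrite !mulmxA.
have S1E : S1 = V1^T *m A0^T *m Q0 *m B.
  rewrite /S1 QVA /B_V !mulmxA -(mulmxA _ V V^T) VVt mulmx1.
  by rewrite tr_row_mx !mul_col_mx col_mxKu.
have solP := deflated_cgdare_solP Q0sym Rsym RW AV2 V11 VV.
have Q11E : Q11 = V1^T *m Q0 *m V1 by rewrite /Q11 /Q_V blockV block_mxKul.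
have Q12E : Q12 = V1^T *m Q0 *m V2 by rewrite /Q12 /Q_V blockV block_mxKur.
have Q22E : Q22 = V2^T *m Q0 *m V2 by rewrite /Q22 /Q_V blockV block_mxKdr.
rewrite Q1E S1E; split=> [X /(cgdare_sol_feedback _ _ Pi_psd)|D /solP].
- case=> Xsym [L [eqX eqL]] X_V.
  have XV2 : (X - Q0) *m V2 = 0.
    exact: (riccati_fixed_subspace Q0sym Rsym RW AV2 Xsym eqX eqL).
  have XQ2 : X *m V2 = Q0 *m V2 by apply/subr0_eq; rewrite -mulmxBl.
  have V2X : V2^T *m (X - Q0) = 0.
    by apply: trmx_inj; rewrite trmx_mul trmxK linearB /= Xsym Q0sym XV2 trmx0.
  split.
  + by rewrite /X_V blockV block_mxKur block_mxKdr -!mulmxA XQ2 Q12E Q22E !mulmxA.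
  (* The reduced Popov matrix is a sum of two congruences, one of [Q0] and one of [R], both positive
     semidefinite. *)
  + have -> : popov (V1^T *m A0^T *m Q0 *m A0 *m V1) (V1^T *m A0^T *m Q0 *m B)
        R1 = (row_mx (A0 *m V1) B)^T *m Q0 *m row_mx (A0 *m V1) B +
             (row_mx 0 1%:M)^T *m R *m row_mx 0 1%:M.
      rewrite /popov !tr_row_mx mul_col_mx mul_col_row mul_col_mx mul_col_row.
      rewrite add_block_mx trmx0 trmx1.
      rewrite !(mul0mx, mulmx0, mul1mx, mulmx1, addr0) !trmx_mul !trmxK Q0sym.
      by rewrite !mulmxA addrC.
    apply: psdmxD; apply: psdmx_gram => //.
    exact: psdmx_drsub Pi_psd.
  + have -> : ulsubmx X_V - Q11 = V1^T *m (X - Q0) *m V1.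
      by rewrite /X_V blockV block_mxKul Q11E [_ *m (X - Q0)]mulmxBr mulmxBl.
    apply/solP.
    (* [X - Q0] is annihilated by [V2] on the right and by [V2^T] on the left, so it is recovered
       from its compression by [V1]. *)
    suff <- : X = Q0 + V1 *m (V1^T *m (X - Q0) *m V1) *m V1^T.
      by split=> //; exists L.
    have V1X : V1 *m V1^T *m (X - Q0) = X - Q0.
      rewrite -[RHS]mul1mx -VV mulmxDl -[V2 *m _ *m _]mulmxA V2X mulmx0.
      by rewrite addr0.
    have XV1 : (X - Q0) *m (V1 *m V1^T) = X - Q0.
      by rewrite -[RHS]mulmx1 -VV [RHS]mulmxDr (mulmxA _ V2) XV2 mul0mx addr0.
    by rewrite !mulmxA V1X -mulmxA XV1 addrC subrK.
- move=> sol; apply/(cgdare_sol_feedback _ _ Pi_psd).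
  suff -> : V *m block_mx (D + Q11) Q12 Q12^T Q22 *m V^T =
      Q0 + V1 *m D *m V1^T by [].
  (* The given block matrix is [Q0] in the basis [V] plus [D] in the upper-left corner. *)
  have -> : block_mx (D + Q11) Q12 Q12^T Q22 =
      V^T *m Q0 *m V + block_mx D 0 0 0.
    rewrite blockV add_block_mx !addr0 Q12E Q22E Q11E !trmx_mul trmxK Q0sym.
    by rewrite mulmxA [D + _]addrC.
  rewrite mulmxDr mulmxDl !mulmxA VVt mul1mx -mulmxA VVt mulmx1.
  by rewrite mul_row_block tr_row_mx mul_row_col !mulmx0 !addr0 mul0mx addr0.
Qed.
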